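(* For every $l\in\mathbb N$, the polynomial $P_l(u,v)\in\mathbb C[u,v]$ defined by $\det(H_l+\lambda\,\mathrm{Id})=P_l(\lambda,\mu^2)$ is irreducible.
   Context: For $l\in\mathbb N$ and $\mu\in\mathbb C$, $H_l$ is the tridiagonal $l\times l$ matrix with entries $H_{l;jj}=(1-j)(l-j+1)$, $H_{l;j,j+1}=\mu j$, $H_{l;j,j-1}=\mu(l-j+1)$, and $H_{l;ij}=0$ if $|i-j|\geq 2$. It is known that $\det(H_l+\lambda\,\mathrm{Id})$ is a polynomial of degree $l$ in the variables $(u,v)=(\lambda,\mu^2)$; this polynomial is denoted $P_l(u,v)$. *)

(* Defs.v *)
From HB Require Import structures.
From mathcomp Require Import all_boot all_order all_algebra.
From mathcomp Require Import reals complex.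
Set Implicit Arguments. Unset Strict Implicit. Unset Printing Implicit Defensive.
Import Order.TTheory GRing.Theory Num.Theory.
Local Open Scope ring_scope.

(* The l x l tridiagonal matrix H_l(mu).  Row/column index i : 'I_l stands for
   j = i+1 in the paper's 1-based indexing:
     H_{jj}     = (1-j)(l-j+1)  = - i (l - i)
     H_{j,j+1}  = mu j          = mu (i+1)
     H_{j,j-1}  = mu (l-j+1)    = mu (l - i)
     other entries 0. *)
Definition Hmat (F : nzRingType) (l : nat) (mu : F) : 'M[F]_l :=
  \matrix_(i < l, k < l)
    if i == k :> nat then - ((i * (l - i))%N)%:R
    else if k == i.+1 :> nat then mu * (i.+1)%:R
    else if i == k.+1 :> nat then mu * ((l - i)%N)%:R
    else 0.

(* Bivariate polynomials in (u,v): the inner variable is u, the outer one is v.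
   eval2 P u v = P(u,v). *)
Definition eval2 (F : comNzRingType) (P : {poly {poly F}}) (u v : F) : F :=
  (P.[v%:P]).[u].

Definition irreducible2 (F : idomainType) (P : {poly {poly F}}) : Prop :=
  P \isn't a GRing.unit /\
  forall a b : {poly {poly F}}, P = a * b -> a \is a GRing.unit \/ b \is a GRing.unit.

(* Main.v *)
Require Import Defs.
From HB Require Import structures.
From mathcomp Require Import all_boot all_order all_algebra.
From mathcomp Require Import reals complex.
From mathcomp Require Import ring lra zify.
Import Order.TTheory GRing.Theory Num.Theory.
Local Open Scope ring_scope.

(** Write [c_k = k (l - k)].  The determinant is the continuant [D_l] given by
    [D_(n+1) = (u - c_n) D_n - v c_n D_(n-1)].  Suppose it factors as [a b].

    For the weights [1] of [u] and [2] of [v] the determinant has degree [l], the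
    degree in [u] of its restriction to [v = 0]; hence so does each factor, and
    writing [b = b_0(u) + v b_1(u) + ...] we get [deg b_1 <= deg b_0 - 2].  So
    the residues of [b_1 / b_0] add up to [0]: the slopes at [v = 0] of the
    branches [u(v)] of [b = 0] have sum [0].

    The highest level [c_(l/2)] is either a simple root or a ramified double
    root, so it belongs to one factor only; let [b] be the other one.  Its
    branches start at levels [c_k] with [k < l/2].  The slope is [-1] for [k = 0];
    for [k > 0] it is a negative rational [alpha_k], the same for both branches,
    except that the two slopes are [alpha_k +- sqrt (c_k c_(k+1))], irrational,
    when [l = 2 k + 2].  In that case [b] must contain both branches or neither,
    because the other slopes are rational.  The sum is thus negative unless [b_0],
    hence [b], is constant. *)

(** * Tridiagonal determinants and continuants *)

Definition tridiag {A : comNzRingType} (a b c : nat -> A) (n : nat) : 'M[A]_n :=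
  \matrix_(i < n, j < n)
    if i == j :> nat then a i
    else if j == i.+1 :> nat then b i
    else if i == j.+1 :> nat then c j
    else 0.

Lemma tridiag_minor {A : comNzRingType} (a b c : nat -> A) (n : nat) :
  row' ord_max (col' ord_max (tridiag a b c n.+1)) = tridiag a b c n.
Proof.
by apply/matrixP => i j; rewrite !mxE !lift_max.
Qed.

(** Expansion along the last row, which meets only the columns [n] and [n.+1]; the minor of the
    entry [c n] is then expanded along its last column, where only [b n] is left. *)
Lemma det_tridiagSS {A : comNzRingType} (a b c : nat -> A) (n : nat) :
  \det (tridiag a b c n.+2) =
    a n.+1 * \det (tridiag a b c n.+1) - b n * c n * \det (tridiag a b c n).
Proof.
pose M := tridiag a b c n.+2; pose j0 : 'I_n.+2 := widen_ord (leqnSn _) ord_max.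
have j0M : j0 != ord_max by rewrite -val_eqE /= ltn_eqF.
rewrite (expand_det_row M ord_max) (bigD1 ord_max) //= (bigD1 j0) //= big1 ?addr0; last first.
  move=> j /andP[jM jj0]; rewrite mxE.
  have jn : (j < n)%N.
    by move: (ltn_ord j) jM jj0; rewrite -!val_eqE /=; lia.
  by rewrite !ifN ?mul0r //=; lia.
rewrite /cofactor tridiag_minor mxE eqxx -signr_odd oddD addbb expr0 mul1r.
congr (_ + _).
pose N := row' ord_max (col' j0 M).
rewrite -/N (expand_det_col N ord_max) (bigD1 ord_max) //= big1 ?addr0; last first.
  move=> i iM; rewrite !mxE !lift_max.
  have lmax : lift j0 ord_max = n.+1 :> nat by rewrite /= /bump /= leqnn.
  rewrite lmax.
  have jn : (i < n)%N by move: (ltn_ord i) iM; rewrite -!val_eqE /=; lia.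
  by rewrite !ifN ?mul0r //=; lia.
rewrite /cofactor.
have -> : row' ord_max (col' ord_max N) = tridiag a b c n.
  apply/matrixP => i j; rewrite !mxE !lift_max.
  have lij : lift j0 (lift ord_max j) = j :> nat.
    by rewrite /= /bump /= (leqNgt n j) ltn_ord !add0n leqNgt ltn_ord.
  by rewrite lij.
have -> : N ord_max ord_max = b n.
  rewrite !mxE lift_max.
  have lmax : lift j0 ord_max = n.+1 :> nat by rewrite /= /bump /= leqnn.
  by rewrite lmax /= eqxx ifN //; lia.
rewrite mxE /= (gtn_eqF (ltnSn n)) ifN ?eqxx; last by lia.
have sgn m : (-1) ^+ (m + m) = 1 :> A by rewrite -signr_odd oddD addbb.
rewrite addSn exprS !sgn; ring.
Qed.

Fixpoint continuant {A : comNzRingType} (c : nat -> A) (x w : A) (n : nat) : A :=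
  match n with
  | 0 => 1
  | m.+1 => (x - c m) * continuant c x w m -
      w * c m * (match m with 0 => 0 | m'.+1 => continuant c x w m' end)
  end.

(** At [n = 0] the index [n.-1] is again [0], and [c 0 = 0] removes the spurious term. *)
Lemma continuantS {A : comNzRingType} (c : nat -> A) (x w : A) (n : nat) :
  c 0%N = 0 ->
  continuant c x w n.+1 =
    (x - c n) * continuant c x w n - w * c n * continuant c x w n.-1.
Proof. by case: n => [|n] //= ->; ring. Qed.

(** The weighted substitution, the restriction to a line, [v = 0] and evaluation at a point are all
    ring morphisms, so each acts on a continuant through its parameters. *)
Lemma rmorph_continuant {A B : comNzRingType} (f : {rmorphism A -> B})
    (c : nat -> A) (c' : nat -> B) (x w : A) (n : nat) :
  (forall i, f (c i) = c' i) ->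
  f (continuant c x w n) = continuant c' (f x) (f w) n.
Proof.
move=> fc; suff: f (continuant c x w n) = continuant c' (f x) (f w) n /\
   f (continuant c x w n.+1) = continuant c' (f x) (f w) n.+1 by case.
elim: n => [|n [IH1 IH2]].
  by split; rewrite /= ?rmorphB ?rmorphM ?rmorphB ?rmorph1 ?rmorph0 ?fc.
split=> //; rewrite [in LHS]/= -/(continuant _ _ _ n.+1) rmorphB !rmorphM rmorphB.
by rewrite IH1 IH2 fc.
Qed.

Lemma continuant0 {A : comNzRingType} (c : nat -> A) (x : A) (n : nat) :
  continuant c x 0 n = \prod_(i < n) (x - c i).
Proof.
elim: n => [|n IH]; first by rewrite big_ord0.
by rewrite big_ord_recr /= -IH mul0r mul0r subr0 mulrC.
Qed.

(** Off-diagonal entries enter the determinant only through the products [b i * c i]; for [Hmat]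
    these involve only [mu ^ 2]. *)
Lemma det_tridiag {A : comNzRingType} (a b c : nat -> A) (e : nat -> A) (x w : A) n :
  (forall i, (i < n)%N -> a i = x - e i) ->
  (forall i, (i.+1 < n)%N -> b i * c i = w * e i.+1) ->
  \det (tridiag a b c n) = continuant e x w n.
Proof.
elim/ltn_ind: n => -[|[|n]] IH ha hbc.
- by rewrite det_mx00.
- by rewrite det_mx11 mxE /= ha //; ring.
rewrite det_tridiagSS ha // hbc // !IH //=.
- by move=> i hi; apply: ha; lia.
- by move=> i hi; apply: hbc; lia.
- by move=> i hi; apply: ha; lia.
by move=> i hi; apply: hbc; lia.
Qed.

(** * Residues of a quotient of polynomials *)

(** One linear factor is cancelled on both sides at a time: at its own root the exponent drops by
    one, and at any other root it is coprime to the power tested. *)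
Lemma dvdp_prod_XsubC_local {F : fieldType} (s : seq F) (q : {poly F}) :
  (forall x n, ('X - x%:P) ^+ n %| \prod_(y <- s) ('X - y%:P) ->
     ('X - x%:P) ^+ n %| q) ->
  \prod_(y <- s) ('X - y%:P) %| q.
Proof.
elim: s q => [|y s IH] q hq; first by rewrite big_nil dvd1p.
have: ('X - y%:P) ^+ 1 %| q by apply: hq; rewrite big_cons expr1 dvdp_mulr.
rewrite expr1 => /dvdpP[r qE].
rewrite qE big_cons mulrC dvdp_mul2r ?polyXsubC_eq0 //.
apply: IH => x n hx; have [xy|xy] := eqVneq x y.
  have := hq x n.+1; rewrite big_cons qE exprS xy mulrC => h.
  rewrite -(@dvdp_mul2r _ ('X - y%:P)) ?polyXsubC_eq0 //.
  by apply: h; rewrite mulrC dvdp_mul2l ?polyXsubC_eq0 // -xy.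
have := hq x n; rewrite big_cons qE => h.
have cop : coprimep (('X - x%:P) ^+ n) ('X - y%:P).
  by apply: coprimep_expl; apply: coprimep_XsubC2; rewrite subr_eq0 eq_sym.
by rewrite -(Gauss_dvdpl _ cop); apply: h; rewrite dvdp_mull.
Qed.

(* The partial fraction expansion of [q / p] has the residue [X c] at each root
   [c] of [p]; the sum of the residues is the coefficient of [1 / 'X] at
   infinity, which vanishes by the degree bound. *)
Lemma sum_residues {F : fieldType} (s T : seq F) (p q : {poly F}) (X : F -> F) :
  p %= \prod_(y <- s) ('X - y%:P) -> uniq T ->
  (forall x, root p x = (x \in T)) ->
  ((size q).+1 < size p)%N || (q == 0) ->
  (forall x, x \in T -> exists n f g, [/\ p = ('X - x%:P) ^+ n.+1 * f, f.[x] != 0,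
      q = ('X - x%:P) ^+ n * g & g.[x] = X x * f.[x]]) ->
  \sum_(x <- T) X x = 0.
Proof.
move=> ps uT rT sq loc.
have p0 : p != 0 by rewrite -size_poly_eq0 (eqp_size ps) size_prod_XsubC.
have pE x : x \in T -> p = p %/ ('X - x%:P) * ('X - x%:P).
  by rewrite -rT => rx; rewrite divpK // dvdp_XsubCl.
(* [D / p] is [q / p] minus its polar parts, all of them simple poles. So [p] divides [D], which has
   smaller degree and must vanish. *)
pose D := q - \sum_(x <- T) X x *: (p %/ ('X - x%:P)).
have sdiv x : x \in T -> size (p %/ ('X - x%:P)) = (size p).-1.
  by move=> xT; rewrite size_divp ?polyXsubC_eq0 // size_XsubC subn1.
have sp : (0 < size p)%N by rewrite size_poly_gt0.
have sqp : (size q < size p)%N.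
  by case/orP: sq => [|/eqP ->]; [lia | rewrite size_poly0].
have sD : (size D < size p)%N.
  apply: leq_ltn_trans (size_polyD _ _) _; rewrite gtn_max sqp size_polyN /=.
  rewrite -[X in (_ < X)%N](prednK sp) ltnS big_seq.
  apply: leq_trans (size_sum _ _ _) _; apply/bigmax_leqP_seq => x _ xT.
  by apply: leq_trans (size_scale_leq _ _) _; rewrite sdiv.
have pD : p %| D.
  rewrite (eqp_dvdl _ ps); apply: dvdp_prod_XsubC_local => x [|n].
    by move=> _; rewrite expr0; apply: dvd1p.
  rewrite -(eqp_dvdr _ ps) => hx.
  have xT : x \in T.
    by rewrite -rT -dvdp_XsubCl (dvdp_trans _ hx) // exprS dvdp_mulr.
  have [m [f [g [pm f0 qm gf]]]] := loc x xT.
  have nm : (n <= m)%N.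
    rewrite leqNgt; apply/negP => mn.
    have: ('X - x%:P) ^+ m.+2 %| p by apply: dvdp_trans hx; rewrite dvdp_exp2l.
    rewrite pm exprSr dvdp_mul2l ?expf_neq0 ?polyXsubC_eq0 // dvdp_XsubCl.
    by move/rootP/eqP; rewrite (negPf f0).
  apply: (@dvdp_trans _ (('X - x%:P) ^+ m.+1)); first by rewrite dvdp_exp2l.
  rewrite /D (bigD1_seq x) //= opprD addrA dvdp_sub //.
    have -> : p %/ ('X - x%:P) = ('X - x%:P) ^+ m * f.
      by rewrite pm exprS -mulrA mulrC mulpK ?polyXsubC_eq0.
    rewrite qm scalerAr -mulrBr exprSr dvdp_mul2l ?expf_neq0 ?polyXsubC_eq0 //.
    by rewrite dvdp_XsubCl; apply/rootP; rewrite !hornerE gf subrr.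
  rewrite big_seq_cond; apply: (big_ind (fun r => _ %| r)) => [|u v hu hv|y /andP[yT yx]].
  - exact: dvdp0.
  - exact: dvdp_add.
  rewrite -mul_polyC; apply: dvdp_mull.
  have: ('X - x%:P) ^+ m.+1 %| p by rewrite pm dvdp_mulr.
  rewrite {1}(pE y yT) Gauss_dvdpl //.
  by apply: coprimep_expl; apply: coprimep_XsubC2; rewrite subr_eq0.
have D0 : D = 0.
  apply/eqP; apply: contraLR sD => Dn0; rewrite -leqNgt; exact: dvdp_leq.
(* Coefficients in degree [deg p - 1] are compared: [q] has none, and each [p %/ ('X - x%:P)]
   contributes the leading coefficient of [p]. *)
have qc : q`_(size p).-2 = 0.
  case/orP: sq => [h|/eqP ->]; last by rewrite coef0.
  apply: nth_default; by move: h; case: (size p) => [|[|k]].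
have: D`_(size p).-2 = 0 by rewrite D0 coef0.
rewrite coefB qc coef_sum sub0r => /eqP; rewrite oppr_eq0 => /eqP.
have lead x : x \in T -> (p %/ ('X - x%:P))`_(size p).-2 = lead_coef p.
  move=> xT; rewrite [in RHS](pE x xT) lead_coef_Mmonic ?monicXsubC //.
  by rewrite lead_coefE sdiv.
under eq_big_seq => x xT do rewrite coefZ lead //.
rewrite -mulr_suml => /eqP; rewrite mulf_eq0 lead_coef_eq0 (negPf p0) orbF.
by move/eqP.
Qed.

(** * Weighted degree *)

(* The substitution [v := tau * u ^ 2], from [K[u][v]] to [K[tau][u]]: the degree
   in [u] of the image is the degree for the weights [1] of [u] and [2] of [v]. *)
Definition weighted {K : idomainType} : {poly {poly K}} -> {poly {poly K}} :=
  horner_eval ('X%:P * 'X ^+ 2) \o map_poly (map_poly polyC).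
HB.instance Definition _ (K : idomainType) :=
  GRing.RMorphism.on (@weighted K).

(** The monomial [u ^ n * v ^ i] becomes [tau ^ i * u ^ (n + 2 i)]; distinct monomials keep distinct
    images, so nothing cancels. *)
Lemma coef_weighted {K : idomainType} (a : {poly {poly K}}) (n i : nat) :
  ((weighted a)`_(n + i.*2))`_i = (a`_i)`_n.
Proof.
rewrite /weighted /= /horner_eval (@horner_coef_wide _ (maxn (size a) i.+1)); last first.
  by rewrite (leq_trans (size_poly _ _)) // leq_maxl.
have hi : (i < maxn (size a) i.+1)%N by rewrite leq_maxr.
have cf (j : nat) : ((map_poly (map_poly polyC) a)`_j * ('X%:P * 'X ^+ 2) ^+ j)
     `_(n + i.*2) `_i = if j == i then (a`_i)`_n else 0.
  rewrite exprMn -rmorphXn /= -exprM mulrC -mulrA coefCM mulrC mul2n mulrC.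
  rewrite (coefXnM j.*2) coef_map /=.
  have [lt|ge] := ltnP (n + i.*2) j.*2.
    by rewrite mulr0 coef0; case: eqP => // ji; lia.
  rewrite coef_map /= mulrC coefCM coefXn eq_sym.
  case: eqVneq => [ij|ij]; last by rewrite mulr0.
  by rewrite mulr1 ij addnK.
rewrite !coef_sum (bigD1 (Ordinal hi)) //= cf eqxx big1 ?addr0 // => j.
by rewrite -val_eqE /= cf => /negPf ->.
Qed.

Lemma leq_size_weighted {K : idomainType} (a : {poly {poly K}}) (n i : nat) :
  (size (weighted a) <= n + i.*2)%N -> (a`_i)`_n = 0.
Proof. by move=> h; rewrite -coef_weighted (nth_default 0 h) coef0. Qed.

Lemma size_coef0_weighted {K : idomainType} (a : {poly {poly K}}) :
  (size (a`_0)%R <= size (weighted a))%N.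
Proof.
apply/leq_sizeP => n hn; by apply: leq_size_weighted; rewrite double0 addn0.
Qed.

(** Both degrees are additive on products and the weighted one is never the smaller, so equality for
    the product forces equality for each factor. *)
Lemma size_weighted_factor {K : idomainType} (a b : {poly {poly K}}) :
  (a * b)`_0 != 0 -> (size (weighted (a * b)%R) <= size ((a * b)`_0)%R)%N ->
  size (weighted b) = size b`_0.
Proof.
rewrite coef0M rmorphM => ab0 /=; move: (ab0); rewrite mulf_eq0 negb_or => /andP[a0 b0].
have := size_coef0_weighted a; have := size_coef0_weighted b.
have sz (p : {poly K}) (q : {poly {poly K}}) : p != 0 -> (size p <= size q)%N -> q != 0.
  by move=> p0 pq; rewrite -size_poly_gt0 (leq_trans _ pq) // size_poly_gt0.
move=> hb ha; have wa := sz _ _ a0 ha; have wb := sz _ _ b0 hb.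
have aux (p q r s : nat) : (0 < p)%N -> (0 < q)%N -> (p <= r)%N -> (q <= s)%N ->
    ((r + s).-1 <= (p + q).-1)%N -> s = q by lia.
by rewrite !size_mul //; apply: aux; rewrite ?size_poly_gt0.
Qed.

Lemma leq_size_mul {R : nzSemiRingType} (p q : {poly R}) (m n : nat) :
  (size p <= m.+1)%N -> (size q <= n)%N -> (size (p * q)%R <= m + n)%N.
Proof.
move=> hp hq; apply: leq_trans (size_polyMleq _ _) _.
by rewrite -subn1 leq_subLR add1n -addSn leq_add.
Qed.

(** In the recursion [x - c n] has weight at most 1 and goes back one index, while [w * c n] has
    weight at most 2 and goes back two. *)
Lemma size_weighted_continuant {K : idomainType} (c : nat -> K) (n : nat) :
  (size (weighted (continuant (fun i => (c i)%:P%:P) 'X%:P 'X n)) <= n.+1)%N.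
Proof.
have wX : weighted (K := K) 'X = 'X%:P * 'X ^+ 2.
  by rewrite /weighted /= /horner_eval map_polyX hornerX.
have wu : weighted (K := K) 'X%:P = 'X.
  by rewrite /weighted /= /horner_eval map_polyC hornerC /= map_polyX.
have wc i : weighted (c i)%:P%:P = (c i)%:P%:P.
  by rewrite /weighted /= /horner_eval map_polyC hornerC /= map_polyC.
have -> : weighted (continuant (fun i => (c i)%:P%:P) 'X%:P 'X n) =
    continuant (fun i => (c i)%:P%:P) 'X ('X%:P * 'X ^+ 2) n.
  transitivity (continuant (fun i => (c i)%:P%:P) (weighted 'X%:P) (weighted 'X) n).
    exact: (@rmorph_continuant {poly {poly K}} {poly {poly K}} weighted).
  by rewrite wX wu.
elim/ltn_ind: n => -[|n] IH; first by rewrite size_poly1.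
rewrite [continuant _ _ _ _]/= (leq_trans (size_polyD _ _)) // geq_max size_polyN.
apply/andP; split.
  apply: leq_trans (size_polyMleq _ _) _; rewrite size_XsubC /=.
  by rewrite ltnS IH.
case: n IH => [|n] IH; first by rewrite mulr0 size_poly0.
set D := continuant _ _ _ n.
have -> : 'X%:P * 'X ^+ 2 * (c n.+1)%:P%:P * D = 'X ^+ 2 * ('X%:P * ((c n.+1)%:P%:P * D)).
  have aux (R : comPzRingType) (p q r s : R) : p * q * r * s = q * (p * (r * s)) by ring.
  exact: aux.
apply: (leq_size_mul _ _ 2 n.+1); first by rewrite size_polyXn.
by do 2?[apply: (leq_size_mul _ _ 0 n.+1); first exact: size_polyC_leq1]; apply: IH.
Qed.

(** * Restriction to lines *)

(* The restriction of a polynomial in [u, v] to the line [u = c + t v]. *)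
Definition on_line {K : comNzRingType} (c t : K) : {poly {poly K}} -> {poly K} :=
  horner_eval 'X \o map_poly (comp_poly (c%:P + t *: 'X)).
HB.instance Definition _ (K : comNzRingType) (c t : K) :=
  GRing.RMorphism.on (on_line c t).

Lemma coef_on_line {K : comNzRingType} (c t : K) (a : {poly {poly K}}) (j : nat) :
  (on_line c t a)`_j = \sum_(i < j.+1) (a`_i \Po (c%:P + t *: 'X))`_(j - i).
Proof.
rewrite /on_line /= /horner_eval (@horner_coef_wide _ (maxn (size a) j.+1)); last first.
  by rewrite (leq_trans (size_poly _ _)) // leq_maxl.
have cf (i : nat) : (map_poly (comp_poly (c%:P + t *: 'X)) a)`_i = a`_i \Po (c%:P + t *: 'X).
  by rewrite coef_map.
rewrite coef_sum (big_ord_widen (maxn (size a) j.+1)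
  (fun i => (a`_i \Po (c%:P + t *: 'X))`_(j - i))) ?leq_maxr // [RHS]big_mkcond.
apply: eq_bigr => i _; rewrite cf coefMXn ltnS.
by case: ltnP.
Qed.

Lemma coef0_comp_line {K : comNzRingType} (c t : K) (p : {poly K}) :
  (p \Po (c%:P + t *: 'X))`_0 = p.[c].
Proof. by rewrite -horner_coef0 horner_comp !hornerE. Qed.

Lemma coefS_comp_line {K : comNzRingType} (c t : K) (p : {poly K}) (j : nat) :
  ((('X - c%:P) * p) \Po (c%:P + t *: 'X))`_j.+1 = t * (p \Po (c%:P + t *: 'X))`_j.
Proof.
rewrite comp_polyM comp_polyB comp_polyX comp_polyC addrC addKr.
by rewrite -scalerAl coefZ coefXM.
Qed.

Lemma on_line0 {K : comNzRingType} (c t : K) (a : {poly {poly K}}) :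
  (on_line c t a)`_0 = (a`_0).[c].
Proof. by rewrite coef_on_line big_ord1 coef0_comp_line. Qed.

Lemma on_line1 {K : comNzRingType} (c t : K) (a : {poly {poly K}}) (f : {poly K}) :
  a`_0 = ('X - c%:P) * f -> (on_line c t a)`_1 = t * f.[c] + (a`_1).[c].
Proof.
move=> af; rewrite coef_on_line !big_ord_recl big_ord0 /= addr0 af.
by rewrite coefS_comp_line !coef0_comp_line.
Qed.

(** As [u - c] restricts to [t v], what remains is the quadratic Taylor part at [(c, 0)] in the
    direction [(t, 1)]. *)
Lemma on_line2 {K : comNzRingType} (c t : K) (a : {poly {poly K}}) (f g : {poly K}) :
  a`_0 = ('X - c%:P) * (('X - c%:P) * f) -> a`_1 = ('X - c%:P) * g ->
  (on_line c t a)`_2 = t ^+ 2 * f.[c] + t * g.[c] + (a`_2).[c].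
Proof.
move=> af ag; rewrite coef_on_line !big_ord_recl big_ord0 /= addr0 af ag.
by rewrite !coefS_comp_line !coef0_comp_line; ring.
Qed.

(** * Residues of a factor at simple and double points *)

(* [c] is a root of [b(u, 0)], and [X] is the residue there of the logarithmic
   derivative of [b] in the direction [v] at [v = 0]: minus the sum of the
   slopes of the branches of [b = 0] through the point [(c, 0)]. *)
Definition has_residue {K : comNzRingType} (b : {poly {poly K}}) (c X : K) : Prop :=
  exists n f g, [/\ b`_0 = ('X - c%:P) ^+ n.+1 * f, f.[c] != 0,
    b`_1 = ('X - c%:P) ^+ n * g & g.[c] = X * f.[c]].

Lemma XsubC_factor {K : idomainType} (c : K) (p : {poly K}) :
  p.[c] = 0 -> exists f, p = ('X - c%:P) * f.
Proof. by move/rootP/factor_theorem => [f ->]; exists f; rewrite mulrC. Qed.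

Lemma linear_eq {K : comNzRingType} (A B A' B' : K) :
  (forall t, A * t + B = A' * t + B') -> A = A' /\ B = B'.
Proof.
move=> h; have hB : B = B' by have := h 0; rewrite !mulr0 !add0r.
by split=> //; have := h 1; rewrite !mulr1 hB => /addIr.
Qed.

Lemma quadratic_eq {K : numDomainType} (A B D A' B' D' : K) :
  (forall t, A * t ^+ 2 + B * t + D = A' * t ^+ 2 + B' * t + D') ->
  [/\ A = A', B = B' & D = D'].
Proof.
move=> h; have hA : A = A'.
  apply: (@pmulrnI _ 2) => //.
  have -> : A *+ 2 = (A * 1 ^+ 2 + B * 1 + D) + (A * (- 1) ^+ 2 + B * (- 1) + D)
    - (A * 0 ^+ 2 + B * 0 + D) *+ 2 by ring.
  by rewrite !h; ring.
have [] // := @linear_eq _ B D B' D' => t.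
by have := h t; rewrite hA -!addrA => /addrI.
Qed.

(** Since [a] does not vanish at [(c, 0)], the linear part of [a * b] there is a constant times that
    of [b], so the branch of slope [alpha] belongs to [b]. *)
Lemma has_residue_simple {K : numFieldType} (a b : {poly {poly K}}) (c alpha C : K) :
  C != 0 -> (forall t, (on_line c t (a * b))`_1 = C * (t - alpha)) ->
  (b`_0).[c] = 0 -> (a`_0).[c] != 0 -> has_residue b c (- alpha).
Proof.
move=> C0 hl bc ac; have [f bf] := XsubC_factor _ _ bc.
have [hC hb] : (a`_0).[c] * f.[c] = C /\ (a`_0).[c] * (b`_1).[c] = - (C * alpha).
  apply: linear_eq => t; rewrite -mulrBr -hl rmorphM /= coefM.
  rewrite !big_ord_recl big_ord0 /= !on_line0 bc mulr0 !addr0.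
  by rewrite (on_line1 _ _ _ _ bf); ring.
have f0 : f.[c] != 0 by apply: contraNneq C0 => f0; rewrite -hC f0 mulr0.
exists 0%N, f, b`_1; split; rewrite ?expr1 ?expr0 ?mul1r //.
by apply: (mulfI ac); rewrite hb -hC; ring.
Qed.

(** If [a] also vanishes at [(c, 0)], the quadratic part splits into a linear part from each factor,
    and [- X] is one of its roots [t]. Otherwise [b] carries both branches and [- X] is the sum
    [2 alpha] of the roots. *)
Lemma has_residue_double {K : numFieldType} (a b : {poly {poly K}})
    (c alpha delta C : K) :
  C != 0 -> (forall t, (on_line c t (a * b))`_1 = 0) ->
  (forall t, (on_line c t (a * b))`_2 = C * ((t - alpha) ^+ 2 - delta)) ->
  (b`_0).[c] = 0 ->
  exists X, has_residue b c X /\ (X = - (alpha *+ 2) \/ (X + alpha) ^+ 2 = delta).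
Proof.
move=> C0 hl1 hl2 bc; have [f bf] := XsubC_factor _ _ bc.
have hquad t : C * ((t - alpha) ^+ 2 - delta) =
  C * t ^+ 2 + (- (C * alpha *+ 2)) * t + C * (alpha ^+ 2 - delta) by ring.
have [ac|ac] := eqVneq (a`_0).[c] 0.
  have [e ae] := XsubC_factor _ _ ac.
  have h t : (t * e.[c] + (a`_1).[c]) * (t * f.[c] + (b`_1).[c]) =
      C * ((t - alpha) ^+ 2 - delta).
    rewrite -hl2 rmorphM /= coefM !big_ord_recl big_ord0 /= !on_line0 bc ac.
    by rewrite mulr0 mul0r add0r !addr0 (on_line1 _ _ _ _ bf) (on_line1 _ _ _ _ ae).
  have [hC _ _] : [/\ e.[c] * f.[c] = C,
      e.[c] * (b`_1).[c] + (a`_1).[c] * f.[c] = - (C * alpha *+ 2) &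
      (a`_1).[c] * (b`_1).[c] = C * (alpha ^+ 2 - delta)].
    by apply: quadratic_eq => t; rewrite -hquad -h; ring.
  have f0 : f.[c] != 0 by apply: contraNneq C0 => f0; rewrite -hC f0 mulr0.
  exists ((b`_1).[c] / f.[c]); split.
    by exists 0%N, f, b`_1; split; rewrite ?expr1 ?expr0 ?mul1r ?divfK.
  right; have := h (- ((b`_1).[c] / f.[c])).
  rewrite [in X in _ * X = _]mulNr divfK // addNr mulr0 => /esym/eqP.
  by rewrite mulf_eq0 (negPf C0) /= subr_eq0 => /eqP <-; ring.
(* Here [a] is invertible at the point, so the linear part of [b] vanishes: [c] is a double root of
   [b_0] and a root of [b_1]. *)
have h1 t : (on_line c t b)`_1 = 0.
  have := hl1 t; rewrite rmorphM /= coefM !big_ord_recl big_ord0 /= !on_line0 bc.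
  by rewrite mulr0 !addr0 => /eqP; rewrite mulf_eq0 (negPf ac) /= => /eqP.
have [fc b1] : f.[c] = 0 /\ (b`_1).[c] = 0.
  apply: linear_eq => t; rewrite mul0r addr0 -(h1 t) (on_line1 _ _ _ _ bf); ring.
have [g bg] := XsubC_factor _ _ b1; have [f2 ff] := XsubC_factor _ _ fc.
rewrite ff in bf.
have [hC hg _] : [/\ (a`_0).[c] * f2.[c] = C,
    (a`_0).[c] * g.[c] = - (C * alpha *+ 2) &
    (a`_0).[c] * (b`_2).[c] = C * (alpha ^+ 2 - delta)].
  apply: quadratic_eq => t; rewrite -hquad -hl2 rmorphM /= coefM.
  rewrite !big_ord_recl big_ord0 /= !on_line0 bc !(h1 t).
  by rewrite !mulr0 !addr0 (on_line2 _ _ _ _ _ bf bg); ring.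
have f0 : f2.[c] != 0 by apply: contraNneq C0 => f0; rewrite -hC f0 mulr0.
exists (- (alpha *+ 2)); split; last by left.
exists 1%N, f2, g; split; rewrite ?expr1 // ?bf ?expr2 ?mulrA //.
by apply: (mulfI ac); rewrite hg -hC; ring.
Qed.

(** * The spectral polynomial on lines through its levels *)

Definition level {K : nzRingType} (l n : nat) : K := (n * (l - n))%:R.

Definition spectral_poly (K : comNzRingType) (l : nat) : {poly {poly K}} :=
  continuant (fun i => (level l i)%:P%:P) 'X%:P 'X l.

Definition line_continuant {K : comNzRingType} (l k : nat) (t : K) (n : nat) : {poly K} :=
  continuant (fun i => (level l i)%:P) ((level l k)%:P + t *: 'X) 'X n.

Lemma on_line_spectral {K : comNzRingType} (l k : nat) (t : K) :
  on_line (level l k) t (spectral_poly K l) = line_continuant l k t l.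
Proof.
have oX : on_line (level l k) t 'X = 'X.
  by rewrite /on_line /= /horner_eval map_polyX hornerX.
have ou : on_line (level l k) t 'X%:P = (level l k)%:P + t *: 'X.
  by rewrite /on_line /= /horner_eval map_polyC hornerC /= comp_polyX.
have oc i : on_line (level l k) t (level l i)%:P%:P = (level l i)%:P.
  by rewrite /on_line /= /horner_eval map_polyC hornerC /= comp_polyC.
rewrite /line_continuant -ou -[X in continuant _ _ X]oX.
exact: (@rmorph_continuant {poly {poly K}} {poly K} (on_line (level l k) t)).
Qed.

(** The constant term of [u - c_n] on the line through [(c_k, 0)]. Among [n <= l] it vanishes
    exactly at [n = k] and [n = l - k], where the recursion changes behaviour. *)
Definition gap {K : nzRingType} (l k n : nat) : K := level l k - level l n.

Lemma line_continuantS {K : comNzRingType} (l k : nat) (t : K) (n : nat) :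
  line_continuant l k t n.+1 =
    gap l k n *: line_continuant l k t n + 'X * (t *: line_continuant l k t n
      - level l n *: line_continuant l k t n.-1).
Proof.
rewrite /line_continuant continuantS; last by rewrite /level mul0n polyC0.
by rewrite -!mul_polyC /gap polyCB; ring.
Qed.

(** For [x = k] and [y = l - k] this is [c_k / (c_k - c_(k-1)) + c_(k+1) / (c_k - c_(k+1))], the
    second-order perturbation of the level [c_k] by its two neighbours. *)
Definition slope {F : fieldType} (x y : F) : F :=
  x * y / (y - x + 1) - (x + 1) * (y - 1) / (y - x - 1).

Section LineCoefficients.
Context {K : numFieldType}.
Context (k k' : nat).
Local Notation l := (k + k')%N.
Local Notation c := (@level K l).
Local Notation e := (@gap K l k).
Local Notation D := (line_continuant l k).

(** The coefficients of [1], [v] and [v ^ 2]; the first does not depend on [t], hence the choice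
    [t = 0]. *)
Let p n : K := (D 0 n)`_0.
Let q t n : K := (D t n)`_1.
Let r t n : K := (D t n)`_2.

Lemma gapE n : (n <= l)%N -> e n = (n%:R - k%:R) * (n%:R - k'%:R).
Proof.
by move=> nl; rewrite /gap /level addKn !natrM natrB // natrD; ring.
Qed.

Lemma gap_eq0 n : (n <= l)%N -> (e n == 0) = (n == k) || (n == k').
Proof.
by move=> nl; rewrite gapE // mulf_eq0 !subr_eq0 !eqr_nat.
Qed.

Lemma coef0_line t n : (D t n)`_0 = p n.
Proof.
elim: n => [|n IH]; first by rewrite /p.
by rewrite /p !line_continuantS !coefD !coefXM !coefZ /= -/(p n) IH.
Qed.

Let pS n : p n.+1 = e n * p n.
Proof. by rewrite /p line_continuantS coefD coefXM coefZ addr0. Qed.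

Let qS t n : q t n.+1 = e n * q t n + t * p n - c n * p n.-1.
Proof.
by rewrite /q line_continuantS coefD coefXM coefB !coefZ /= !coef0_line addrA.
Qed.

Let rS t n : r t n.+1 = e n * r t n + t * q t n - c n * q t n.-1.
Proof. by rewrite /r line_continuantS coefD coefXM coefB !coefZ /= addrA. Qed.

Let prod_gap (f : nat -> K) m n :
  (forall i, (m <= i)%N -> f i.+1 = e i * f i) -> (m <= n)%N ->
  f n = (\prod_(m <= i < n) e i) * f m.
Proof.
move=> hf; elim: n => [|n IH].
  by rewrite leqn0 => /eqP ->; rewrite big_geq // mul1r.
rewrite leq_eqVlt => /predU1P[->|mn]; first by rewrite big_geq // mul1r.
by rewrite big_nat_recr //= hf // IH //; ring.
Qed.

Let prod_gap_neq0 m n : (n <= l.+1)%N ->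
  (forall i, (m <= i < n)%N -> i != k /\ i != k') -> \prod_(m <= i < n) e i != 0.
Proof.
move=> nl h; rewrite prodf_seq_neq0; apply/allP => i; rewrite mem_index_iota => hi /=.
have [ik ik'] := h i hi; rewrite gap_eq0 ?negb_or ?ik ?ik' //.
by case/andP: hi => _; lia.
Qed.

Let p0E : p 0 = 1. Proof. by rewrite /p coef1. Qed.

Let p_zero n : (k < n)%N -> p n = 0.
Proof.
case: n => // n; rewrite ltnS => kn; rewrite (prod_gap p k) ?leqW //.
by rewrite big_nat_recl //= /gap subrr !mul0r.
Qed.

Let p_prefix n : p n = \prod_(0 <= i < n) e i.
Proof. by rewrite (prod_gap p 0) // p0E mulr1. Qed.

Let p_k_neq0 : (k <= k')%N -> p k != 0.
Proof. by move=> kk'; rewrite p_prefix prod_gap_neq0 //; lia. Qed.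

Let q_tail t n : (k.+2 <= n)%N -> q t n = (\prod_(k.+2 <= i < n) e i) * q t k.+2.
Proof.
apply: prod_gap => i hi; rewrite qS !p_zero ?mulr0 ?addr0 ?subr0 //; lia.
Qed.

Let q_top t : q t k.+1 = t * p k - c k * p k.-1.
Proof. by rewrite qS /gap subrr mul0r add0r. Qed.

Let q_top2 t : q t k.+2 = e k.+1 * q t k.+1 - c k.+1 * p k.
Proof. by rewrite qS p_zero // mulr0 addr0. Qed.

Let q_zero t n : (k.+2 <= k')%N -> (k' < n)%N -> q t n = 0.
Proof.
move=> kk' kn; rewrite q_tail; last by lia.
rewrite (big_cat_nat _ (n := k')) //=; last by lia.
rewrite (big_ltn kn).
by rewrite (eqP (_ : e k' == 0)) ?mul0r ?mulr0 ?mul0r // gap_eq0 ?eqxx ?orbT //; lia.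
Qed.

(** At level zero [e 1 = - c 1], so [q t 2 = e 1 * t - c 1] is [e 1 * (t + 1)]: the slope is
    [-1]. *)
Lemma line_zero_coef1 :
  k = 0%N -> (2 <= k')%N -> exists2 C : K, C != 0 & forall t : K, (D t l)`_1 = C * (t + 1).
Proof.
move=> k0 k2; exists ((\prod_(k.+2 <= i < l) e i) * e 1%N).
  rewrite mulf_neq0 //; first by apply: prod_gap_neq0; lia.
  by rewrite gap_eq0 ?negb_or; lia.
move=> t; rewrite -/(q t l) q_tail; last by lia.
have [pk pk1] : p k = 1 /\ p k.-1 = 1 by rewrite k0 p0E.
rewrite q_top2 q_top pk pk1.
rewrite -mulrA; congr (_ * _); rewrite !(gapE k.+1) ?(gapE 1); [|by lia..].
rewrite /level k0 !mul0n add0n mul1n natrB; last by lia.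
ring.
Qed.

(** For [k' = k] the top level is a simple root and the coefficient is a nonconstant affine function
    of [t]. For [k' = k.+1] with [k > 0] it is a nonzero multiple of [c k.+1 * p k], the mark of
    ramification. For [l = 1] it is [t]. *)
Lemma line_top_coef1 :
  (0 < l)%N -> (k <= k' <= k.+1)%N -> exists t : K, (D t l)`_1 != 0.
Proof.
move=> l0 /andP[kk' k'k].
have [E|Nkk'] := eqVneq k' k.
  suff: q 1 l - q 0 l != 0.
    have [-> h|h _] := eqVneq (q 0 l) 0; last by exists 0.
    by exists 1; rewrite subr0 in h.
  rewrite (prod_gap (fun n => q 1 n - q 0 n) k.+1); first last.
  - by lia.
  - move=> i hi; rewrite !qS (p_zero i) //; ring.
  rewrite mulf_neq0 //; first by apply: prod_gap_neq0; lia.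
  by rewrite !q_top mul1r mul0r (_ : _ - _ = p k) ?p_k_neq0 //; ring.
have [k0|k0] := posnP k.
  exists 1; rewrite -/(q 1 l) (_ : l = k.+1); last by lia.
  rewrite q_top /level k0 /= p0E; rewrite (_ : _ - _ = 1) ?oner_neq0 //; ring.
exists 0; rewrite -/(q 0 l) q_tail; last by lia.
rewrite mulf_neq0 //; first by apply: prod_gap_neq0; lia.
rewrite q_top2 (eqP (_ : e k.+1 == 0)); last by rewrite gap_eq0; lia.
rewrite mul0r sub0r oppr_eq0 mulf_neq0 ?p_k_neq0 //.
by rewrite /level pnatr_eq0; lia.
Qed.


Let r_tail t n : (k.+2 <= k')%N -> (k'.+2 <= n)%N ->
  r t n = (\prod_(k'.+2 <= i < n) e i) * r t k'.+2.
Proof.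
move=> kk'; apply: prod_gap => i hi.
by rewrite rS !q_zero ?mulr0 ?addr0 ?subr0 //; lia.
Qed.

(** For [k = 1] the index [l] lies just before the tail. One further step of the recursion, where
    [q t l = 0] and [c l = 0], gives [r t l.+1 = c k * r t l], and [l.+1] is always in the tail. *)
Let r_l t : (0 < k)%N -> (k.+2 <= k')%N ->
  r t l = (\prod_(k'.+2 <= i < l.+1) e i) / c k * r t k'.+2.
Proof.
move=> k0 kk'; have ck : c k != 0 by rewrite /level pnatr_eq0; lia.
apply: (mulfI ck); rewrite mulrA mulrCA divff // mulr1 -r_tail //; last by lia.
have cl : c l = 0 by rewrite /level subnn muln0.
by rewrite rS q_zero //; [rewrite mulr0 addr0 /gap cl mul0r !subr0 | lia].
Qed.

Let r_top t : (k.+2 <= k')%N ->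
  r t k'.+2 = e k'.+1 * (t * q t k' - c k' * q t k'.-1) - c k'.+1 * q t k'.
Proof.
move=> kk'; rewrite !rS (q_zero t k'.+1) // mulr0 addr0.
by rewrite (eqP (_ : e k' == 0)) ?mul0r ?add0r // gap_eq0 ?eqxx ?orbT //; lia.
Qed.

Lemma line_double :
  (0 < k)%N -> (k.+2 <= k')%N ->
  (forall t : K, (D t l)`_1 = 0) /\
  exists2 C : K, C != 0 & forall t : K, (D t l)`_2 = C *
    ((t - slope k%:R k'%:R) ^+ 2 - if k' == k.+2 then c k * c k.+1 else 0).
Proof.
move=> k0 kk'; split; first by move=> t; apply: q_zero => //; lia.
have cE n : (n <= l)%N -> c n = n%:R * (k%:R + k'%:R - n%:R).
  by move=> nl; rewrite /level natrM natrB // natrD.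
have kE : k%:R = k.-1%:R + 1 :> K by rewrite -{1}(prednK k0) -natr1.
have pk : p k = (k'%:R - k%:R + 1) * p k.-1.
  rewrite -{1}(prednK k0) pS gapE; last by lia.
  rewrite kE; ring.
have pk0 : p k.-1 != 0.
  by move: (p_k_neq0 (ltnW (ltnW kk'))); rewrite pk mulf_eq0 negb_or => /andP[].
have d1 : k'%:R - k%:R + 1 != 0 :> K.
  by rewrite -natrB ?natr1 ?pnatr_eq0 //; lia.
have d0 : k'%:R - k%:R - 1 != 0 :> K.
  have -> : k'%:R - k%:R - 1 = (k' - k - 1)%:R :> K by rewrite !natrB //; lia.
  by rewrite pnatr_eq0; lia.
(* [- A] is [e k.+1 * p k], the coefficient of [t] in [q t k.+2]. *)
pose A := (k'%:R - k%:R + 1) * (k'%:R - k%:R - 1) * p k.-1.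
have qE t : q t k.+2 = - A * (t - slope k%:R k'%:R).
  rewrite q_top2 q_top pk gapE ?cE; try lia.
  by rewrite /slope /A -!natr1; field; rewrite d1 d0.
have c0 : (\prod_(k'.+2 <= i < l.+1) e i) / c k != 0.
  rewrite mulf_neq0 ?invr_eq0 //; first by apply: prod_gap_neq0; lia.
  by rewrite /level pnatr_eq0; lia.
have A0 : A != 0 by rewrite !mulf_neq0.
(* For [k' = k.+2], [q t k'.-1] is [q t k.+1], which precedes the tail, and the form fails to be a
   square by [c k * c k.+1]. The constant [-9] is the product of [e k'.+1 = 3] and the [-3] in
   [- A = -3 * p k.-1]. *)
have [E|N] := eqVneq k' k.+2.
  exists ((\prod_(k'.+2 <= i < l.+1) e i) / c k * (- 9%:R * p k.-1)).
    by rewrite mulf_neq0 // mulf_neq0 // oppr_eq0 pnatr_eq0.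
  move=> t; rewrite -/(r t l) r_l // -[RHS]mulrA; congr (_ * _).
  have [qa qb] : q t k' = q t k.+2 /\ q t k'.-1 = q t k.+1 by rewrite E.
  rewrite r_top // qa qb /= qE q_top pk gapE ?cE; try lia.
  have k'E : k'%:R = k%:R + 2%:R :> K by rewrite E -natrD addn2.
  have -> : slope k%:R k'%:R = k%:R * (k%:R + 2%:R) / 3%:R - (k%:R + 1) ^+ 2 :> K.
    rewrite /slope k'E (_ : k%:R + 2%:R - k%:R + 1 = 3%:R); last by ring.
    by rewrite (_ : k%:R + 2%:R - k%:R - 1 = 1) ?divr1; ring.
  by rewrite /A -!natr1 k'E; field.
exists ((\prod_(k'.+2 <= i < l.+1) e i) / c k *
   (A * ((k'%:R - k%:R + 1) * (k'%:R - k%:R - 1)) * \prod_(k.+2 <= i < k'.-1) e i)).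
  rewrite mulf_neq0 // !mulf_neq0 //; apply: prod_gap_neq0; lia.
move=> t; rewrite -/(r t l) r_l // -[RHS]mulrA; congr (_ * _).
(* Now [q t k'.-1] and [q t k'] both lie in the tail and carry the factor [t - slope]; the remaining
   linear factor has the same root, giving a square. *)
have k'E : k'%:R = k'.-1%:R + 1 :> K by rewrite -{1}(ltn_predK kk') -natr1.
have qk' : q t k' = - (k'%:R - k%:R - 1) * q t k'.-1.
  rewrite -{1}(ltn_predK kk') qS !p_zero ?mulr0 ?addr0 ?subr0; try lia.
  by rewrite gapE; [rewrite k'E; ring | lia].
rewrite r_top // qk' q_tail; last by lia.
rewrite qE gapE ?cE; try lia.
by rewrite subr0 /slope /A -!natr1; field; rewrite d1 d0.
Qed.

End LineCoefficients.

(** * Sign and rationality of the residues *)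

(** The subtracted fraction has the larger numerator and the smaller positive denominator. Writing
    [k' = k + d + 2] and clearing denominators leaves a polynomial in [k] and [d] with visibly
    positive value. *)
Lemma slope_lt0 {F : realFieldType} (k k' : nat) :
  (0 < k)%N -> (k.+2 <= k')%N -> slope k%:R k'%:R < 0 :> F.
Proof.
move=> k0 kk'; have [d ->] : exists d, k' = (k + d + 2)%N by exists (k' - k - 2)%N; lia.
have x0 : 0 < k%:R :> F by rewrite ltr0n.
have d0 : 0 <= d%:R :> F by apply: ler0n.
rewrite /slope !natrD; set x := k%:R; set y := d%:R.
have -> : x + y + 2%:R - x + 1 = y + 3%:R by ring.
have -> : x + y + 2%:R - x - 1 = y + 1 by ring.
rewrite subr_lt0 ltr_pdivrMr; last by rewrite /y; lra.
rewrite mulrAC ltr_pdivlMr; last by rewrite /y; lra.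
rewrite -subr_gt0.
have -> : (x + 1) * (x + y + 2%:R - 1) * (y + 3%:R) - x * (x + y + 2%:R) * (y + 1) =
  (x ^+ 2 + x * y + x *+ 2) *+ 2 + (y + 1) * (y + 3%:R) by ring.
apply: ltr_wpDl; last by apply: mulr_gt0; lra.
by rewrite mulrn_wge0 // !addr_ge0 ?mulrn_wge0 ?mulr_ge0 ?exprn_ge0 // ltW.
Qed.

Lemma ratr_slope {K : numFieldType} (k k' : nat) :
  ratr (slope k%:R k'%:R) = slope k%:R k'%:R :> K.
Proof.
by rewrite /slope !(rmorphB, rmorphM, rmorphD, fmorphV, rmorph_nat, rmorph1) /=.
Qed.

Lemma rat_sqr_nat (q : rat) (N : nat) : q ^+ 2 = N%:R -> exists n, N = (n ^ 2)%N.
Proof.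
move=> qN; have d0 : (denq q)%:~R != 0 :> rat by rewrite intr_eq0 denq_neq0.
have h : (numq q) ^+ 2 = N%:Z * (denq q) ^+ 2.
  by apply: (@intr_inj rat); rewrite [RHS]rmorphM /= !rmorphXn /= numqE exprMn qN -pmulrn.
have /= {}h := congr1 absz h; rewrite abszM !abszX absz_nat in h.
have cop : coprime (`|numq q| ^ 2) (`|denq q| ^ 2).
  by rewrite coprimeXl // coprimeXr // coprime_num_den.
have d1 : (`|denq q| ^ 2 = 1)%N.
  rewrite -[RHS](eqP cop); apply/esym/gcdn_idPr.
  by rewrite h dvdn_mull.
by exists `|numq q|%N; rewrite h d1 muln1.
Qed.

(** With [N = (k + 1) ^ 2] the product of levels is [N (N - 1)], strictly between the consecutive
    squares [(N - 1) ^ 2] and [N ^ 2]. *)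
Lemma no_rat_sqrt {K : numFieldType} (k : nat) (q : rat) : (0 < k)%N ->
  ratr q ^+ 2 != level (k + k.+2) k * level (k + k.+2) k.+1 :> K.
Proof.
move=> k0; apply/eqP; rewrite /level -natrM -rmorphXn /= -(ratr_nat K) => /fmorph_inj.
case/rat_sqr_nat => n.
have -> : (k + k.+2 - k = k.+2)%N by lia.
have -> : (k + k.+2 - k.+1 = k.+1)%N by lia.
have lt : (n < k.+1 * k.+1)%N \/ (k.+1 * k.+1 <= n)%N by lia.
nia.
Qed.

Lemma on_line1_eq0 {K : comNzRingType} (a b : {poly {poly K}}) (c t : K) :
  (a`_0).[c] = 0 -> (b`_0).[c] = 0 -> (on_line c t (a * b))`_1 = 0.
Proof.
move=> ac bc; rewrite rmorphM /= coefM !big_ord_recl big_ord0 /= !on_line0 ac bc.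
by rewrite mul0r mulr0 !addr0.
Qed.

Lemma spectral_residue {K : numFieldType} (k k' : nat) (a b : {poly {poly K}}) :
  (k.+2 <= k')%N -> spectral_poly K (k + k') = a * b ->
  (b`_0).[level (k + k') k] = 0 ->
  exists X, has_residue b (level (k + k') k) X /\
    ((exists2 q : rat, 0 < q & X = ratr q) \/ (k' = k.+2 /\ forall q, X != ratr q)).
Proof.
move=> kk' ab bc.
have hab t : on_line (level (k + k') k) t (a * b) = line_continuant (k + k') k t (k + k').
  by rewrite -ab on_line_spectral.
have [k0|k0] := posnP k.
  have [C C0 hC] := @line_zero_coef1 K k k' k0 (leq_trans (isT : (2 <= k.+2)%N) kk').
  exists (- (- 1)); split; last by left; exists 1; rewrite ?opprK ?rmorph1.
  apply: (@has_residue_simple _ a b _ (- 1) C) => //.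
    by move=> t; rewrite hab hC opprK.
  (* A common zero of [a] and [b] would kill the linear part for every [t], yet at [t = 0] it equals
     [C]. *)
  apply/eqP => ac; move: C0.
  by rewrite -[C]mulr1 -[X in C * X]add0r -hC -hab on_line1_eq0 ?eqxx.
have [h1 [C C0 h2]] := @line_double K k k' k0 kk'.
have hl1 t : (on_line (level (k + k') k) t (a * b))`_1 = 0 by rewrite hab h1.
have [X [hX hX']] := has_residue_double _ _ _ _ _ _ C0 hl1
  (fun t => etrans (congr1 (fun p : {poly K} => p`_2) (hab t)) (h2 t)) bc.
exists X; split=> //.
have s0 := @slope_lt0 rat k k' k0 kk'.
case: hX' => [->|].
  left; exists (- (slope k%:R k'%:R *+ 2)); first by rewrite oppr_gt0 pmulrn_llt0.
  by rewrite rmorphN rmorphMn /= ratr_slope.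
case: eqP => [E|_] hX'.
  right; split=> // q; apply/eqP => Xq.
  have := @no_rat_sqrt K k (q + slope k%:R k'%:R) k0.
  by rewrite rmorphD /= ratr_slope -Xq -E hX' eqxx.
left; exists (- slope k%:R k'%:R); first by rewrite oppr_gt0.
rewrite rmorphN /= ratr_slope; apply/eqP; rewrite -addr_eq0 -sqrf_eq0.
exact/eqP.
Qed.

Lemma seq_choice {T : eqType} {U : Type} (u0 : U) (s : seq T) (R : T -> U -> Prop) :
  (forall x, x \in s -> exists y, R x y) ->
  exists f : T -> U, forall x, x \in s -> R x (f x).
Proof.
elim: s => [|x s IH] h; first by exists (fun=> u0).
have [f hf] := IH (fun y ys => h y (mem_behead (s := x :: s) ys)).
have [y hy] := h x (mem_head _ _).
exists (fun z => if z == x then y else f z) => z; rewrite inE.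
by case: eqP => [->|_] //= /hf.
Qed.

(** A nonempty sum of positive rationals is positive; a single irrational term, at [z], cannot be
    cancelled by rational ones. *)
Lemma sum_pos_rat_eq0 {K : numFieldType} (T : seq K) (X : K -> K) (z : K) :
  uniq T ->
  (forall x, x \in T -> (exists2 q : rat, 0 < q & X x = ratr q) \/
     (x = z /\ forall q, X x != ratr q)) ->
  \sum_(x <- T) X x = 0 -> T = [::].
Proof.
move=> uT hX S0.
have [hall|[zT hz]] : (forall x, x \in T -> exists2 q : rat, 0 < q & X x = ratr q) \/
    (z \in T /\ forall q, X z != ratr q).
- have [zT|zT] := boolP (z \in T); last first.
    by left=> x xT; case: (hX x xT) => // -[xz _]; rewrite -xz xT in zT.
  case: (hX z zT) => [hz|[_ hz]]; last by right.
  by left=> x xT; case: (hX x xT) => // -[-> _].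
- have Xpos x : x \in T -> 0 < X x by move=> /hall[q q0 ->]; rewrite ltr0q.
  case: T Xpos S0 {uT hX hall} => // x T Xpos; rewrite big_cons => S0.
  suff: 0 < X x + \sum_(y <- T) X y by rewrite S0 ltxx.
  apply: ltr_wpDr; last by apply: Xpos; apply: mem_head.
  by rewrite big_seq sumr_ge0 // => y yT; rewrite ltW // Xpos // inE yT orbT.
have [q hq] : exists q, \sum_(x <- T | x != z) X x = ratr q.
  rewrite big_seq_cond; apply: (big_ind (fun y => exists q, y = ratr q)).
  - by exists 0; rewrite rmorph0.
  - by move=> _ _ [q1 ->] [q2 ->]; exists (q1 + q2); rewrite rmorphD.
  move=> x /andP[xT xz]; case: (hX x xT) => [[q _ ->]|[E _]]; first by exists q.
  by rewrite E eqxx in xz.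
have := hz (- q); rewrite rmorphN /= -hq; move: S0; rewrite (bigD1_seq z) //= => /eqP.
by rewrite addr_eq0 => ->.
Qed.

(** * Factors of the spectral polynomial *)

Lemma spectral_coef0 {K : comNzRingType} (l : nat) :
  (spectral_poly K l)`_0 = \prod_(i < l) ('X - (level l i)%:P).
Proof.
rewrite -(continuant0 (fun i => (level l i)%:P)) -horner_coef0 /spectral_poly.
have h0 : horner_eval (0 : {poly K}) 'X = 0 by rewrite /horner_eval hornerX.
have hu : horner_eval (0 : {poly K}) 'X%:P = 'X by rewrite /horner_eval hornerC.
have hc i : horner_eval (0 : {poly K}) (level l i)%:P%:P = (level l i)%:P.
  by rewrite /horner_eval hornerC.
transitivity (continuant (fun i => (level l i)%:P) (horner_eval (0 : {poly K}) 'X%:P)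
    (horner_eval (0 : {poly K}) 'X) l); last by rewrite h0 hu.
exact: (@rmorph_continuant {poly {poly K}} {poly K} (horner_eval 0)).
Qed.

Lemma size_spectral_coef0 {K : idomainType} (l : nat) :
  size (spectral_poly K l)`_0 = l.+1.
Proof. by rewrite spectral_coef0 size_prod_XsubC /index_enum -enumT size_enum_ord. Qed.

Lemma level_inj {K : numDomainType} (l i j : nat) :
  (i <= l./2)%N -> (j <= l./2)%N -> level l i = level l j :> K -> i = j.
Proof.
move=> il jl /eqP; rewrite /level eqr_nat => /eqP h.
have [i' li] : exists i', l = (i + i' + i)%N /\ (i <= l)%N by exists (l - i - i)%N; lia.
have [j' lj] : exists j', l = (j + j' + j)%N /\ (j <= l)%N by exists (l - j - j)%N; lia.
move: h; rewrite {1}(proj1 li) {1}(proj1 lj) -!addnA !addKn.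
nia.
Qed.

Lemma level_low_index {K : nzRingType} (l i : nat) :
  (i <= l)%N -> exists2 k, (k <= l./2)%N & level l i = level l k :> K.
Proof.
move=> il; have [h|h] := leqP i l./2; first by exists i.
by exists (l - i)%N; [lia | rewrite /level subKn // mulnC].
Qed.

Lemma spectral_factor_unit {K : numFieldType} (l : nat) (a b : {poly {poly K}}) :
  (0 < l)%N -> spectral_poly K l = a * b ->
  (b`_0).[level l l./2] != 0 -> b \is a GRing.unit.
Proof.
move=> l0 ab btop.
have P0 : (a * b)`_0 != 0 by rewrite -ab -size_poly_gt0 size_spectral_coef0.
have b0 : b`_0 != 0 by move: P0; rewrite coef0M mulf_eq0 negb_or => /andP[].
have wb : size (weighted b) = size b`_0.
  apply: size_weighted_factor P0 _; rewrite -ab size_spectral_coef0.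
  exact: size_weighted_continuant.
have [s bs] : exists s, b`_0 %= \prod_(y <- s) ('X - y%:P).
  have : b`_0 %| \prod_(i < l) ('X - (level l i)%:P).
    by rewrite -spectral_coef0 ab coef0M dvdp_mull.
  case/dvdp_prod_XsubC => m hm.
  by exists (map (fun i : 'I_l => level l i) (mask m (index_enum _))); rewrite big_map.
(* The distinct roots of [b_0]: by [c_k = c_(l-k)] the indices up to [l./2] suffice, and [btop]
   excludes [l./2] itself. *)
pose T : seq K := [seq level l k | k <- iota 0 l./2 & root b`_0 (level l k)].
have uT : uniq T.
  rewrite map_inj_in_uniq ?filter_uniq ?iota_uniq // => i j.
  rewrite !mem_filter !mem_iota => /andP[_ hi] /andP[_ hj].
  by apply: level_inj; lia.
have rT x : root b`_0 x = (x \in T).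
  apply/idP/mapP => [rx|[k]]; last by rewrite mem_filter => /andP[rk _] ->.
  have : root (\prod_(i < l) ('X - (level l i)%:P)) x.
    by rewrite -spectral_coef0 ab coef0M rootM rx orbT.
  rewrite rootE horner_prod prodf_seq_eq0 => /hasP[i _] /=.
  rewrite !hornerE subr_eq0 => /eqP xi.
  have [k kl ki] := @level_low_index K l i (ltnW (ltn_ord i)).
  exists k; rewrite ?xi // mem_filter mem_iota -ki -xi rx /=.
  move: kl; rewrite leq_eqVlt => /predU1P[kl|//].
  by move: btop; rewrite -kl -ki -xi -rootE rx.
(* An irrational residue requires [l = 2 k + 2], that is [k = l./2.-1], so it occurs at one level at
   most. *)
have hX x : x \in T -> exists X, has_residue b x X /\
   ((exists2 q : rat, 0 < q & X = ratr q) \/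
    (x = level l l./2.-1 /\ forall q, X != ratr q)).
  case/mapP => k; rewrite mem_filter mem_iota => /andP[rk kl] ->.
  have lE : l = (k + (l - k))%N by lia.
  have := @spectral_residue K k (l - k) a b; rewrite -lE => /(_ _ ab (rootP rk)).
  case=> [|X [hX [?|[lk hq]]]]; first by lia.
    by exists X; split=> //; left.
  by exists X; split=> //; right; split=> //; congr level; lia.
have [X hX'] := seq_choice 0 T _ hX.
have sb1 : (size (b`_1)%R <= size (b`_0)%R - 2)%N.
  apply/leq_sizeP => n hn; apply: leq_size_weighted; rewrite wb; lia.
have S0 : \sum_(x <- T) X x = 0.
  apply: (sum_residues s T b`_0 b`_1 X bs uT rT).
    rewrite -size_poly_eq0; move: sb1; move: (size b`_1) (size b`_0) => m n.
    by case: m => [|m]; lia.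
  by move=> x /hX'[].
have T0 : T = [::] by apply: (sum_pos_rat_eq0 T X _ uT _ S0) => x /hX'[_]; exact.
have s0 : s = [::].
  case: s bs => // y s bs; have := rT y.
  by rewrite T0 in_nil (eqp_root bs) root_prod_XsubC mem_head.
have sb : size b`_0 = 1%N by rewrite (eqp_size bs) s0 big_nil size_poly1.
(* The weighted degree of [b] is now zero, so no positive power of [v] survives. *)
have bC : b = (b`_0)%:P.
  apply/polyP => i; rewrite coefC; case: eqP => [->//|i0].
  apply/polyP => n; rewrite coef0; apply: leq_size_weighted; rewrite wb sb; lia.
have b00 : b`_0 \is a GRing.unit.
  rewrite poly_unitE sb eqxx unitfE; move: b0.
  by rewrite {1}[b`_0]size1_polyC ?sb // polyC_eq0.
by rewrite poly_unitE {1}bC size_polyC b0 b00.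
Qed.

Lemma spectral_poly_irreducible {K : numFieldType} (l : nat) :
  (0 < l)%N -> irreducible2 (spectral_poly K l).
Proof.
move=> l0; split.
  rewrite poly_unitE negb_and; apply/orP; right.
  by rewrite poly_unitE size_spectral_coef0 eqSS (gtn_eqF l0).
move=> a b ab.
have [btop|btop] := eqVneq (b`_0).[level l l./2] 0; last first.
  by right; apply: spectral_factor_unit l0 ab btop.
left; apply: (@spectral_factor_unit _ _ b a l0); first by rewrite ab mulrC.
(* If both factors vanished at the top level, the linear part of their product would be zero on
   every line through it. *)
apply/eqP => atop.
have lE : l = (l./2 + (l - l./2))%N by lia.
have [||t] := @line_top_coef1 K l./2 (l - l./2); [lia | lia |].
by rewrite -lE -on_line_spectral ab on_line1_eq0 ?eqxx.
Qed.

(** * From the determinant to the spectral polynomial *)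

Lemma eval_spectral {K : comNzRingType} (l : nat) (u v : K) :
  eval2 (spectral_poly K l) u v = continuant (level l) u v l.
Proof.
pose f : {rmorphism {poly {poly K}} -> K} := horner_eval u \o horner_eval v%:P.
have fX : f 'X = v by rewrite /f /= /horner_eval hornerX hornerC.
have fu : f 'X%:P = u by rewrite /f /= /horner_eval hornerC hornerX.
have fc i : f (level l i)%:P%:P = level l i by rewrite /f /= /horner_eval !hornerC.
by have := @rmorph_continuant {poly {poly K}} K f _ _ 'X%:P 'X l fc; rewrite fX fu.
Qed.

Lemma det_Hmat {K : comNzRingType} (l : nat) (mu lambda : K) :
  \det (Hmat l mu + lambda%:M) = continuant (level l) lambda (mu ^+ 2) l.
Proof.
rewrite -(@det_tridiag _ (fun i => lambda - level l i) (fun i => mu * i.+1%:R)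
  (fun i => mu * (l - i.+1)%:R)) //; last first.
  by move=> i _; rewrite /level natrM; ring.
congr (\det _); apply/matrixP => i j; rewrite !mxE -val_eqE /=.
case: eqP => [_|_]; first by rewrite /level mulr1n addrC.
by rewrite mulr0n addr0; case: ifP => // _; case: eqP => // ->.
Qed.

Lemma poly_eq_on_seq {K : idomainType} (f : nat -> K) (p q : {poly K}) :
  injective f -> (forall n, p.[f n] = q.[f n]) -> p = q.
Proof.
move=> fi h; apply/eqP; rewrite -subr_eq0; apply/eqP.
apply: (@roots_geq_poly_eq0 _ _ (mkseq f (size (p - q)))).
- by apply/allP => _ /mapP[n _ ->]; rewrite rootE !hornerE h subrr.
- exact: mkseq_uniq.
by rewrite size_mkseq.
Qed.

(** The squares of natural numbers already provide infinitely many values of the second variable. *)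
Lemma eval2_inj {K : numFieldType} (P Q : {poly {poly K}}) :
  (forall u v, eval2 P u (v ^+ 2) = eval2 Q u (v ^+ 2)) -> P = Q.
Proof.
move=> h; apply: (poly_eq_on_seq (fun n => (n%:R ^+ 2)%:P)).
  move=> m n /polyC_inj/eqP; rewrite -!natrX eqr_nat eqn_exp2r // => /eqP //.
move=> n; apply: (poly_eq_on_seq (fun n => n%:R)) => [i j /eqP|i].
  by rewrite eqr_nat => /eqP.
exact: h.
Qed.

Theorem theorem1p2 (R : realType) (l : nat) (P : {poly {poly R[i]}}) :
  (0 < l)%N ->
  (forall lambda mu : R[i],
      \det (Hmat l mu + lambda%:M) = eval2 P lambda (mu ^+ 2)) ->
  irreducible2 P.
Proof.
move=> l0 hP; have -> : P = spectral_poly R[i] l.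
  by apply: eval2_inj => u v; rewrite -hP det_Hmat eval_spectral.
exact: spectral_poly_irreducible.
Qed.
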